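(* For every possibilistic Kripke structure $M$, every state $s$ of $M$, and every state formula $\Phi$ generated by the grammar $\Phi::=true\mid a\mid\Phi_1\wedge\Phi_2\mid\neg\Phi\mid Po_J(\varphi)$, $\varphi::=\bigcirc\Phi\mid\Phi_1\sqcup\Phi_2\mid\Phi_1\sqcup^{\le n}\Phi_2\mid\square\Phi$ (with $a\in AP$, $n\in\mathbb N$, $J\subseteq[0,1]$ an interval with rational bounds), $s$ satisfies $\Phi$ under the RGPoCTL semantics if and only if $s$ satisfies $\Phi$ under the PoCTL semantics; that is, RGPoCTL and PoCTL have the same state formulae.
   Context: A possibilistic Kripke structure (PKS) is a tuple $M=(S,P,I,AP,L)$ with $S$ a countable nonempty set of states, $P:S\times S\to[0,1]$ with $\bigvee_{t}P(s,t)=1$ for all $s$, $I:S\to[0,1]$ with $\bigvee_sI(s)=1$, $AP$ a set of atomic propositions, and crisp labeling $L:S\times AP\to\{0,1\}$ ($a\in L(s)$ iff $L(s,a)=1$). A path is an infinite sequence $\pi=s_0s_1\cdots$ with $P(s_i,s_{i+1})>0$ for all $i$; $\pi[k]=s_k$; $Paths(s)$ is the set of paths with $\pi[0]=s$. For $\pi\in Paths(s)$ let $Po^{M_s}(\pi)=\bigwedge_{i\ge0}P(\pi[i],\pi[i+1])$. $\vee,\wedge$ are sup and inf in $[0,1]$ (empty sup $=0$). In both semantics, state formulae are interpreted crisply: $s\models true$; $s\models a$ iff $a\in L(s)$; $s\models\neg\Phi$ iff $s\not\models\Phi$; $s\models\Phi_1\wedge\Phi_2$ iff both; $s\models Po_J(\varphi)$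 iff $Po(s\models\varphi)\in J$. Crisp path satisfaction (in terms of the state satisfaction of the respective semantics): $\pi\models\bigcirc\Phi$ iff $\pi[1]\models\Phi$; $\pi\models\Phi_1\sqcup\Phi_2$ iff there is $k\ge0$ with $\pi[k]\models\Phi_2$ and $\pi[i]\models\Phi_1$ for all $i<k$; $\sqcup^{\le n}$ likewise with $k\le n$; $\pi\models\square\Phi$ iff $\pi[j]\models\Phi$ for all $j$. PoCTL semantics: $Po(s\models\varphi)=\bigvee\{Po^{M_s}(\pi)\mid\pi\in Paths(s),\pi\models\varphi\}$. RGPoCTL semantics: $Po(s\models\varphi)=\bigvee_{\pi\in Paths(s)}Po^{M_s}(\pi)\wedge\|\varphi\|(\pi)$, where for $\pi=s_0s_1\cdots$: $\|\bigcirc\Phi\|(\pi)=P(s_0,s_1)$ if $\pi\models\bigcirc\Phi$ and $0$ otherwise; $\|\Phi\sqcup\Psi\|(\pi)=\bigvee_{k}\{\bigwedge_{j=0}^{k}P(s_j,s_{j+1})\mid s_j\models\Phi\text{ for all }j<k,\ s_k\models\Psi\}$; $\|\Phi\sqcup^{\le n}\Psi\|(\pi)$ is the same with $k\le n$; $\|\square\Phi\|(\pi)=\bigwedge_{j\ge0}P(s_j,s_{j+1})$ if $\pi\models\square\Phi$ and $0$ otherwise. *)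

(* Defs.v *)
From HB Require Import structures.
From mathcomp Require Import all_boot all_order all_algebra.
From mathcomp Require Import interval_inference.
From mathcomp Require Import boolp classical_sets reals.

Set Implicit Arguments.
Unset Strict Implicit.
Unset Printing Implicit Defensive.

Import Order.TTheory GRing.Theory Num.Theory.

Local Open Scope classical_set_scope.
Local Open Scope ring_scope.

(* All suprema and infima below are of subsets of [0, 1].  Since [sup set0 = 0]
   for [reals.sup], [sup] is the join of the lattice [0, 1] even on the empty
   set; [inf] is only ever applied to nonempty sets. *)

(* Countability of the set of states is carried by [countType]. *)
Record pks (R : realType) := PKS {
  state : countType;
  trans : state -> state -> R;
  init : state -> R;
  AP : Type;
  label : state -> AP -> bool;
  state_nonempty : [set: state] !=set0;
  trans_itv01 : forall s t, 0 <= trans s t <= 1;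
  trans_sup1 : forall s, sup [set trans s t | t in [set: state]] = 1;
  init_itv01 : forall s, 0 <= init s <= 1;
  init_sup1 : sup [set init s | s in [set: state]] = 1
}.

(* Intervals with rational bounds, of any of the open/closed shapes, included in
   [0, 1]: the order on [interval] is inclusion.  Degenerate intervals such as
   ]1, 0[ provide the empty one. *)
Definition rat_itv01 : Type := {J : interval rat | (J <= `[0%R, 1%R])%O}.

(* The type [X] of arguments is instantiated with state formulae (syntax) or
   with sets of states (semantics). *)
Inductive path_formula (X : Type) : Type :=
| Next of X
| Until of X & X
| BUntil of nat & X & X
| Always of X.

Definition path_formula_map (X Y : Type) (f : X -> Y) (phi : path_formula X) :
    path_formula Y :=
  match phi with
  | Next A => Next (f A)
  | Until A B => Until (f A) (f B)
  | BUntil n A B => BUntil n (f A) (f B)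
  | Always A => Always (f A)
  end.

Inductive state_formula (AP : Type) : Type :=
| STrue
| SAtom of AP
| SAnd of state_formula AP & state_formula AP
| SNot of state_formula AP
| SPo of rat_itv01 & path_formula (state_formula AP).

Section Semantics.
Context (R : realType) (M : pks R).
Local Notation S := (state M).
Local Notation P := (@trans R M).

Definition Paths (s : S) : set (nat -> S) :=
  [set pi | pi 0%N = s /\ forall i : nat, 0 < P (pi i) (pi i.+1)].

Definition path_poss (pi : nat -> S) : R :=
  inf [set P (pi i) (pi i.+1) | i in [set: nat]].

(* The first [k.+1] transitions, i.e. those from [pi 0] up to [pi k.+1]. *)
Definition prefix_poss (pi : nat -> S) (k : nat) : R :=
  inf [set P (pi j) (pi j.+1) | j in [set j : nat | (j <= k)%N]].

Definition until_at (A B : set S) (pi : nat -> S) (k : nat) : Prop :=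
  B (pi k) /\ forall i : nat, (i < k)%N -> A (pi i).

Definition path_sat (phi : path_formula (set S)) (pi : nat -> S) : Prop :=
  match phi with
  | Next A => A (pi 1%N)
  | Until A B => exists k : nat, until_at A B pi k
  | BUntil n A B => exists k : nat, (k <= n)%N /\ until_at A B pi k
  | Always A => forall j : nat, A (pi j)
  end.

Definition path_grade (phi : path_formula (set S)) (pi : nat -> S) : R :=
  match phi with
  | Next A => if `[< path_sat (Next A) pi >] then P (pi 0%N) (pi 1%N) else 0
  | Until A B => sup [set prefix_poss pi k | k in [set k | until_at A B pi k]]
  | BUntil n A B =>
      sup [set prefix_poss pi k | k in
             [set k : nat | (k <= n)%N /\ until_at A B pi k]]
  | Always A => if `[< path_sat (Always A) pi >] then path_poss pi else 0
  end.

Definition Po_PoCTL (phi : path_formula (set S)) (s : S) : R :=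
  sup [set path_poss pi | pi in [set pi | Paths s pi /\ path_sat phi pi]].

Definition Po_RGPoCTL (phi : path_formula (set S)) (s : S) : R :=
  sup [set Num.min (path_poss pi) (path_grade phi pi) | pi in Paths s].

(* The set of states satisfying a state formula.  The two semantics differ only
   in the possibility [Po] that a state satisfies a path formula. *)
Fixpoint sat (Po : path_formula (set S) -> S -> R)
    (Phi : state_formula (AP M)) : set S :=
  match Phi with
  | STrue => [set: S]
  | SAtom a => [set s | label s a]
  | SAnd Phi1 Phi2 => sat Po Phi1 `&` sat Po Phi2
  | SNot Phi1 => ~` sat Po Phi1
  | SPo J phi =>
      [set s | Po (path_formula_map (sat Po) phi) s \in map_itv ratr (sval J)]
  end.

Definition sat_PoCTL (Phi : state_formula (AP M)) (s : S) : Prop :=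
  sat Po_PoCTL Phi s.

Definition sat_RGPoCTL (Phi : state_formula (AP M)) (s : S) : Prop :=
  sat Po_RGPoCTL Phi s.

End Semantics.

(* Main.v *)
(** Every prefix of a path is at least as possible as the path itself, so
    taking the minimum of the path's possibility with its RGPoCTL grade gives
    that possibility back when the path satisfies the formula, and 0 otherwise.
    A supremum of nonnegative values is not affected by additional zeros, so
    the possibilities of a path formula agree in both semantics, and hence so
    does the satisfaction of state formulae. *)
Require Import Defs.
From mathcomp Require Import all_boot all_order all_algebra reals.
From mathcomp Require Import boolp classical_sets.

Set Implicit Arguments.
Unset Strict Implicit.
Unset Printing Implicit Defensive.

Import Order.TTheory GRing.Theory Num.Theory.

Local Open Scope classical_set_scope.
Local Open Scope ring_scope.

(** Points of [A] outside [B] only contribute zeros, and the right-hand supremum is nonnegative,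
    even over the empty set, where [sup] defaults to 0. *)
Lemma sup_image_if (R : realType) (T : Type) (A B : set T) (f : T -> R) :
    (forall x, 0 <= f x) -> has_ubound [set f x | x in A `&` B] ->
  sup [set if `[< B x >] then f x else 0 | x in A] =
  sup [set f x | x in A `&` B].
Proof.
move=> f0 ubf; set G := image A _; set F := image _ f.
have supF0 : 0 <= sup F.
  have [->|/set0P[y Fy]] := eqVneq F set0; first by rewrite sup0.
  by apply: le_trans (ub_le_sup ubf Fy); case: Fy => x _ <-.
have ubG : ubound G (sup F).
  move=> _ [x Ax <-]; case: asboolP => // Bx.
  by apply: ub_le_sup => //; exists x.
have FG : F `<=` G by move=> _ [x [Ax Bx] <-]; exists x; rewrite // asboolT.
have [G0|/set0P Gn0] := eqVneq G set0.
  by have -> : F = set0; [rewrite -subset0 -G0|rewrite G0].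
apply/eqP; rewrite eq_le ge_sup //=.
(* Only [sup F <= sup G] remains. If [F] is empty, the left side is 0, which lies below any element
   of [G]. *)
have [->|/set0P Fn0] := eqVneq F set0.
  rewrite sup0; case: Gn0 => y Gy; apply: le_trans (ub_le_sup _ Gy).
    by case: Gy => x _ <-; case: ifP.
  by exists (sup F).
by apply: ge_sup => // y /FG Gy; apply: ub_le_sup => //; exists (sup F).
Qed.

Section Paths.
Context (R : realType) (M : pks R).
Implicit Types (pi : nat -> state M) (phi : path_formula (set (state M))).

Lemma trans_ge0 (s t : state M) : 0 <= trans s t.
Proof. by case/andP: (trans_itv01 s t). Qed.

Lemma trans_le1 (s t : state M) : trans s t <= 1.
Proof. by case/andP: (trans_itv01 s t). Qed.

Lemma has_lbound_trans pi (K : set nat) :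
  has_lbound [set trans (pi i) (pi i.+1) | i in K].
Proof. by exists 0 => _ [i _ <-]; exact: trans_ge0. Qed.

Lemma path_poss_ge0 pi : 0 <= path_poss pi.
Proof.
apply: lb_le_inf => [|_ [i _ <-]]; last exact: trans_ge0.
by exists (trans (pi 0%N) (pi 1%N)), 0%N.
Qed.

Lemma path_poss_le_trans pi i : path_poss pi <= trans (pi i) (pi i.+1).
Proof. by apply: ge_inf; [exact: has_lbound_trans|exists i]. Qed.

Lemma path_poss_le1 pi : path_poss pi <= 1.
Proof. exact: le_trans (path_poss_le_trans pi 0) (trans_le1 _ _). Qed.

Lemma path_poss_le_prefix pi k : path_poss pi <= prefix_poss pi k.
Proof.
apply: lb_le_inf => [|_ [i _ <-]]; last exact: path_poss_le_trans.
by exists (trans (pi 0%N) (pi 1%N)), 0%N.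
Qed.

Lemma prefix_poss_le1 pi k : prefix_poss pi k <= 1.
Proof.
apply: (le_trans _ (trans_le1 (pi 0%N) (pi 1%N))).
by apply: ge_inf; [exact: has_lbound_trans|exists 0%N].
Qed.

(** The index set [K] is arbitrary so as to serve both until operators; prefixes are bounded by 1,
    so the supremum dominates each of them. *)
Lemma path_poss_le_sup_prefix pi (K : set nat) k : K k ->
  path_poss pi <= sup [set prefix_poss pi k | k in K].
Proof.
move=> Kk; apply: le_trans (path_poss_le_prefix pi k) _.
apply: ub_le_sup; last by exists k.
by exists 1 => _ [j _ <-]; exact: prefix_poss_le1.
Qed.

Lemma path_poss_le_grade phi pi :
  path_sat phi pi -> path_poss pi <= path_grade phi pi.
Proof.
case: phi => [A|A B|n A B|A] /=.
- by move=> ?; rewrite asboolT //; exact: path_poss_le_trans.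
- by case=> k; exact: path_poss_le_sup_prefix.
- by case=> k; exact: path_poss_le_sup_prefix.
- by move=> ?; rewrite asboolT.
Qed.

Lemma path_grade_unsat phi pi : ~ path_sat phi pi -> path_grade phi pi = 0.
Proof.
(* An unsatisfied until has no admissible index, so its grade is the supremum of the empty set. *)
have sup_empty (K : set nat) : ~ (exists k, K k) ->
    sup [set prefix_poss pi k | k in K] = 0.
  by move=> /nonemptyPn ->; rewrite image_set0 sup0.
by case: phi => [A|A B|n A B|A] /= nsat; rewrite ?asboolF // sup_empty.
Qed.

Lemma min_path_poss_grade phi pi :
  Num.min (path_poss pi) (path_grade phi pi) =
  if `[< path_sat phi pi >] then path_poss pi else 0.
Proof.
case: asboolP => [/path_poss_le_grade/min_idPl //|/path_grade_unsat ->].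
exact/min_idPr/path_poss_ge0.
Qed.

(** As an equality of functions, this can be rewritten in the parameter [Po] of [sat], which
    replaces an induction on state formulae. *)
Lemma Po_RGPoCTL_PoCTL : @Po_RGPoCTL R M = @Po_PoCTL R M.
Proof.
apply/funext => phi; apply/funext => s; rewrite /Po_RGPoCTL.
under eq_imagel do rewrite min_path_poss_grade.
apply: sup_image_if; first exact: path_poss_ge0.
by exists 1 => _ [pi _ <-]; exact: path_poss_le1.
Qed.

End Paths.

Theorem theorem5 (R : realType) (M : pks R) (s : state M)
    (Phi : state_formula (AP M)) :
  sat_RGPoCTL Phi s <-> sat_PoCTL Phi s.
Proof. by rewrite /sat_RGPoCTL Po_RGPoCTL_PoCTL. Qed.
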